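(* Let $(S,\phi)$ be an interaction which is exchangeable, and let $(X,E)$ be a connected, locally finite symmetric digraph such that $X$ is infinite. Then there is a canonical isomorphism $$\operatorname{Consv}^\phi(S)\cong H^0_{\mathrm{unif}}(S^X),\qquad \xi\mapsto\xi_X,$$ i.e. the map $\xi\mapsto\xi_X$ is an ($\mathbb{R}$-linear) isomorphism from $\operatorname{Consv}^\phi(S)$ onto $H^0_{\mathrm{unif}}(S^X)$.
   Context: Graphs. A symmetric digraph $(X,E)$ is a set $X$ of vertices with a set $E\subset X\times X$ of edges such that $(x,y)\in E$ iff $(y,x)\in E$. It is locally finite if $\{(x,y)\in E\mid y\in X\}$ is finite for every $x\in X$, and connected if any two vertices are joined by a finite path. $d_X$ is the graph distance, and $\operatorname{diam}(\Lambda):=\sup_{x,y\in\Lambda}d_X(x,y)$ for $\Lambda\subset X$ (with $\operatorname{diam}(\emptyset)=0$). Uniform functions. Let $S$ be a non-empty set, $S^X:=\prod_{x\in X}S$ the configuration space. For $\Lambda\subset X$, $C(S^\Lambda)$ is the space of real functions on $S^\Lambda$, viewed as functions on $S^X$ (and on $S^X_*$ below) depending only on the components in $\Lambda$. $\mathscr{I}$ is the set of finite subsets of $X$ (including $\emptyset$). Fix a base state $*\in S$. $S^X_*\subset S^X$ is the set of $\eta$ with $\eta_x=*$ for all but finitely many $x$; $\star$ is the configuration with all components $*$; $C(S^X_* )$ is the space of all functions $S^X_*\to\mathbb{R}$. For $f\in C(S^X_* )$ and $\Lambda\subset X$, $\iota^\Lambda_*f(\eta):=f(\eta|_\Lambda)$,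 where $\eta|_\Lambda$ agrees with $\eta$ on $\Lambda$ and equals $*$ outside $\Lambda$. For $\Lambda\in\mathscr{I}$, $C_\Lambda(S^X_* )$ is the space of $f\in C(S^\Lambda)$ such that $\iota^{\Lambda'}_*f=0$ for every finite $\Lambda'\subset X$ with $\Lambda\not\subset\Lambda'$. Every $f\in C(S^X_* )$ has a unique expansion $f=\sum_{\Lambda\in\mathscr{I}}f^*_\Lambda$ with $f^*_\Lambda\in C_\Lambda(S^X_* )$ (a finite sum at each point of $S^X_*$). $f$ is uniform if there is $R>0$ with $f^*_\Lambda=0$ whenever $\operatorname{diam}(\Lambda)>R$. $C_{\mathrm{unif}}(S^X_* )$ is the space of uniform functions and $C^0_{\mathrm{unif}}(S^X_* )$ its quotient by the constant functions. Independence of base state. For base states $*,*'\in S$ there is an $\mathbb{R}$-linear isomorphism $C_{\mathrm{unif}}(S^X_* )\cong C_{\mathrm{unif}}(S^X_{*'})$ sending $f=\sum_\Lambda f^*_\Lambda$ to $\sum_{\Lambda'\in\mathscr{I}}f^{*'}_{\Lambda'}$, where $f^{*'}_\emptyset:=f(\star)$ and, for $\Lambda'\ne\emptyset$, $f^{*'}_{\Lambda'}:=\sum_{\Lambda\in\mathscr{I},\,\Lambda'\subset\Lambda}(f^*_\Lambda)^{*'}_{\Lambda'}$ (a finite sum), with $(f^*_\Lambda)^{*'}_{\Lambda'}$ the components of the expansion of $f^*_\Lambda\in C(S^\Lambda)\subset C(S^X_{*'})$ for the base state $*'$. It induces an isomorphism $C^0_{\mathrm{unif}}(S^X_* )\cong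 C^0_{\mathrm{unif}}(S^X_{*'})$, and via these identifications the space is simply denoted $C^0_{\mathrm{unif}}(S^X)$. Differences. For $f\in C^0_{\mathrm{unif}}(S^X)$ and $\eta,\eta'\in S^X$ with $\Delta_{\eta,\eta'}:=\{x\in X\mid\eta_x\ne\eta'_x\}$ finite, one defines $f(\eta')-f(\eta):=\sum_{\Lambda\in\mathscr{I},\,\Lambda\cap\Delta_{\eta,\eta'}\neq\emptyset}(f^*_\Lambda(\eta')-f^*_\Lambda(\eta))$, a finite sum independent of the choice of $*$. Interactions. An interaction $(S,\phi)$ is a non-empty set $S$ with a subset $\phi\subset(S\times S)\times(S\times S)$ such that $(S\times S,\phi)$ is a symmetric digraph. It is exchangeable if for any $(s_1,s_2)\in S\times S$, the elements $(s_1,s_2)$ and $(s_2,s_1)$ lie in the same connected component of $(S\times S,\phi)$. A conserved quantity for $(S,\phi)$ is a function $\xi\colon S\to\mathbb{R}$ such that $(s_1,s_2)\mapsto\xi(s_1)+\xi(s_2)$ is constant on the connected components of $(S\times S,\phi)$. $\operatorname{Consv}^\phi(S)$ is the space of conserved quantities modulo the subspace of constant functions. For $\xi\in\operatorname{Consv}^\phi(S)$, $\xi_X:=\sum_{x\in X}\xi_x\in C^0_{\mathrm{unif}}(S^X)$ with $\xi_x(\eta):=\xi(\eta_x)$; concretely, for a base state $*$, taking the representative with $\xi( * )=0$, $\xi_X$ is the class of the function $\eta\mapsto\sum_{x\in X}\xi(\eta_x)$ on $S^X_*$. Uniform cohomology. $\Phi_E\subset S^X\times S^X$ is the set of pairs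 $(\eta,\eta')$ for which there is $e=(x,y)\in E$ with $((\eta_x,\eta_y),(\eta'_x,\eta'_y))\in\phi$ and $\eta_z=\eta'_z$ for all $z\neq x,y$. $C^1(S^X)$ is the space of functions $\omega\colon\Phi_E\to\mathbb{R}$ with $\omega(\eta',\eta)=-\omega(\eta,\eta')$. The differential $\partial\colon C^0_{\mathrm{unif}}(S^X)\to C^1(S^X)$ is $\partial f(\eta,\eta'):=f(\eta')-f(\eta)$ for $(\eta,\eta')\in\Phi_E$, where the difference $f(\eta')-f(\eta)$ means the finite sum $\sum_{\Lambda\in\mathscr{I},\,\Lambda\cap\Delta_{\eta,\eta'}\neq\emptyset}(f^*_\Lambda(\eta')-f^*_\Lambda(\eta))$ with $\Delta_{\eta,\eta'}=\{x\in X\mid\eta_x\neq\eta'_x\}$ (a finite set for $(\eta,\eta')\in\Phi_E$), and $H^0_{\mathrm{unif}}(S^X):=\operatorname{Ker}\partial$. *)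

(* Defs.v *)
From HB Require Import structures.
From mathcomp Require Import all_boot all_order all_algebra.
From mathcomp Require Import generic_quotient ring_quotient finmap.
From mathcomp Require Import all_classical reals.

Set Implicit Arguments.
Unset Strict Implicit.
Unset Printing Implicit Defensive.

Import Order.TTheory GRing.Theory Num.Theory.

Local Open Scope classical_set_scope.
Local Open Scope fset_scope.
Local Open Scope ring_scope.
Local Open Scope quotient_scope.

(* MathComp only equips the quotient by an additive subgroup with a zmodType
   structure; for a submodule W we add the scaling inherited from V. *)
Section LmodQuotient.
Variables (K : pzRingType) (V : lmodType K) (W : submodClosed V).

Definition lquot_pred : {pred V} := fun v => v \in W.

Lemma lquot_zmod_closed : zmod_closed lquot_pred.
Proof.
split=> [|u v uW vW]; first exact: rpred0.
by rewrite /lquot_pred -scaleN1r unfold_in /= rpredD ?rpredZ.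
Qed.
HB.instance Definition _ := GRing.isZmodClosed.Build V lquot_pred lquot_zmod_closed.

Definition lquot := Quotient.quot lquot_pred.
HB.instance Definition _ := GRing.Zmodule.on lquot.

Definition lproj (v : V) : lquot := \pi_(Quotient.quot lquot_pred) v.
Definition lrepr (q : lquot) : V := repr (q : Quotient.quot lquot_pred).

Lemma lreprK : cancel lrepr lproj.
Proof. by move=> q; rewrite /lproj /lrepr reprK. Qed.

Lemma lprojP (u v : V) : reflect (lproj u = lproj v) (u - v \in W).
Proof.
rewrite -[_ \in W]/(u - v \in lquot_pred) Quotient.idealrBE; exact: eqP.
Qed.

Lemma lprojD u v : lproj (u + v) = lproj u + lproj v.
Proof. by rewrite /lproj raddfD. Qed.

Definition lquot_scale (a : K) (q : lquot) : lquot := lproj (a *: lrepr q).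

Lemma lprojZ_subproof a v : lquot_scale a (lproj v) = lproj (a *: v).
Proof.
by apply/lprojP; rewrite -scalerBr rpredZ //; apply/lprojP; rewrite lreprK.
Qed.

Let scaleA a b q : lquot_scale a (lquot_scale b q) = lquot_scale (a * b) q.
Proof. by rewrite -[q]lreprK !lprojZ_subproof scalerA. Qed.
Let scale1 : left_id 1 lquot_scale.
Proof. by move=> q; rewrite -[q]lreprK lprojZ_subproof scale1r. Qed.
Let scaleDr : right_distributive lquot_scale +%R.
Proof.
move=> a p q; rewrite -[p]lreprK -[q]lreprK -lprojD !lprojZ_subproof.
by rewrite scalerDr lprojD.
Qed.
Let scaleDl q : {morph lquot_scale^~ q : a b / a + b}.
Proof.
by move=> a b; rewrite -[q]lreprK !lprojZ_subproof scalerDl lprojD.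
Qed.
HB.instance Definition _ :=
  GRing.Zmodule_isLmodule.Build K lquot scaleA scale1 scaleDr scaleDl.

Lemma lproj_is_linear : linear lproj.
Proof. by move=> a u v; rewrite lprojD -lprojZ_subproof. Qed.
HB.instance Definition _ :=
  GRing.isLinear.Build K V lquot *:%R lproj lproj_is_linear.

End LmodQuotient.

Section Digraph.
Variables (V : Type) (E : set (V * V)).

Definition symmetric_digraph := forall x y, E (x, y) <-> E (y, x).

Definition adj : rel V := fun x y => `[< E (x, y) >].

Definition walk (n : nat) (x y : V) : Prop :=
  exists p : seq V, [/\ path adj x p, last x p = y & size p = n].

Definition joined (x y : V) : Prop := exists n, walk n x y.

Definition connected_digraph := forall x y, joined x y.

Definition locally_finite :=
  forall x, finite_set [set e : V * V | E e /\ e.1 = x].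

(* Total only for convenience: the value 0 for points which are not joined is
   irrelevant in a connected digraph. *)
Definition dist (x y : V) : nat :=
  if pselect (exists n, `[< walk n x y >]) is left h then ex_minn h else 0%N.

Lemma dist_walk n x y : walk n x y -> walk (dist x y) x y /\ (dist x y <= n)%N.
Proof.
move=> w; rewrite /dist; case: pselect => [h|[]]; last first.
  by exists n; apply/asboolP.
by case: ex_minnP => m /asboolP wm mmin; split=> //; apply/mmin/asboolP.
Qed.

Lemma distxx x : dist x x = 0%N.
Proof.
have w : walk 0 x x by exists [::].
by have [_] := dist_walk w; rewrite leqn0 => /eqP.
Qed.

End Digraph.

Definition diam (X : choiceType) (E : set (X * X)) (L : {fset X}) : nat :=
  \max_(x <- L) \max_(y <- L) dist E x y.

(* Function spaces take values in R^o, that is R seen as a module over itself,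
   so that they inherit an R-module structure. *)
Section Configurations.
Variables (R : realType) (X : choiceType) (S : Type).

Section BaseState.
Variables (E : set (X * X)) (b : S).

Definition finconf :=
  {eta : X -> S | finite_set [set x | eta x <> b]}.

Definition supp (eta : finconf) : {fset X} := fset_set [set x | sval eta x <> b].

Lemma suppP (eta : finconf) x : x \notin supp eta -> sval eta x = b.
Proof.
rewrite in_fset_set; last exact: (svalP eta).
by move=> xN; apply: contrapT => h; move/negP: xN; apply; rewrite inE.
Qed.

Definition restr_fun (L : {fset X}) (eta : X -> S) : X -> S :=
  fun x => if x \in L then eta x else b.

Lemma restr_finite L eta : finite_set [set x | restr_fun L eta x <> b].
Proof.
apply: (@sub_finite_set _ _ [set` L]); last exact: finite_fset.
by move=> x /=; rewrite /restr_fun; case: ifP.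
Qed.

Definition restr (L : {fset X}) (eta : X -> S) : finconf :=
  exist _ (restr_fun L eta) (restr_finite L eta).

Lemma finconf_eq (eta zeta : finconf) : sval eta =1 sval zeta -> eta = zeta.
Proof.
by case: eta zeta => [e he] [z hz] /= /funext ez; subst z; congr exist.
Qed.

Lemma restr_restr (L M : {fset X}) eta :
  restr L (sval (restr M eta)) = restr (L `&` M)%fset eta.
Proof.
apply: finconf_eq => x /=; rewrite /restr_fun in_fsetI.
by case: (x \in L); case: (x \in M).
Qed.

Lemma restr_supp (eta : finconf) : restr (supp eta) (sval eta) = eta.
Proof.
apply: finconf_eq => x /=; rewrite /restr_fun.
by case: ifPn => // /suppP ->.
Qed.

Definition iota_restr (L : {fset X}) (f : finconf -> R^o) : finconf -> R^o :=
  fun eta => f (restr L (sval eta)).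

(* Elements of C(S^L) are represented by functions on the whole of X -> S, so
   that the components of f : finconf -> R^o can be evaluated at configurations
   with infinitely many sites different from b. *)
Definition depends_on (L : {fset X}) (g : (X -> S) -> R^o) : Prop :=
  forall eta eta' : X -> S, {in L, eta =1 eta'} -> g eta = g eta'.

Definition CLam (L : {fset X}) (g : (X -> S) -> R^o) : Prop :=
  depends_on L g /\
  forall L' : {fset X}, ~~ (L `<=` L')%fset ->
    iota_restr L' (fun eta : finconf => g (sval eta)) = 0.

Definition is_expansion (f : finconf -> R^o) (F : {fset X} -> (X -> S) -> R^o) :=
  (forall L, CLam L (F L)) /\
  (forall eta : finconf, f eta = \sum_(L \in [set: {fset X}]) F L (sval eta)).

Lemma CLam0 L g (A : {fset X}) eta :
  CLam L g -> ~~ (L `<=` A)%fset -> g (sval (restr A eta)) = 0.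
Proof.
move=> [_ /(_ A) h] /h /(congr1 (@^~ (restr A eta))).
by rewrite -[LHS]/(g (sval (restr A (sval (restr A eta))))) restr_restr fsetIid.
Qed.

Lemma CLam_restr L g (A : {fset X}) eta :
  CLam L g -> (L `<=` A)%fset -> g (sval (restr A eta)) = g eta.
Proof.
move=> [h _] /fsubsetP LA; apply: h => x xL /=.
by rewrite /restr_fun LA.
Qed.

Lemma sum_CLam (F : {fset X} -> (X -> S) -> R^o) (A : {fset X}) eta :
  (forall L, CLam L (F L)) ->
  \sum_(L \in [set: {fset X}]) F L (sval (restr A eta)) =
  \sum_(L <- fpowerset A) F L eta.
Proof.
move=> hF; rewrite (@fsbigTE _ _ _ _ (fpowerset A)); last first.
  by move=> L; rewrite fpowersetE => LA; apply: CLam0.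
rewrite big_seq [RHS]big_seq; apply: eq_bigr => L; rewrite fpowersetE.
by move=> LA; exact: CLam_restr.
Qed.

Lemma sum_CLam_supp (F : {fset X} -> (X -> S) -> R^o) (eta : finconf) :
  (forall L, CLam L (F L)) ->
  \sum_(L \in [set: {fset X}]) F L (sval eta) =
  \sum_(L <- fpowerset (supp eta)) F L (sval eta).
Proof. by move=> hF; rewrite -[in LHS](restr_supp eta) sum_CLam. Qed.

Lemma expansion_powerset f F (A : {fset X}) eta :
  is_expansion f F -> f (restr A eta) = \sum_(L <- fpowerset A) F L eta.
Proof. by move=> [hF ->]; rewrite sum_CLam. Qed.

Lemma big_fpowerset_top (F : {fset X} -> R) (A : {fset X}) :
  \sum_(L <- fpowerset A) F L = F A + \sum_(L <- fpowerset A `\ A) F L.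
Proof. by rewrite (big_fsetD1 A) // fpowersetE fsubset_refl. Qed.

Lemma in_fpowersetD1 (A L : {fset X}) : L \in fpowerset A `\ A = (L `<` A)%fset.
Proof. by rewrite in_fsetD1 fpowersetE fproperEneq. Qed.

Lemma expansion_unique f F G : is_expansion f F -> is_expansion f G -> F = G.
Proof.
move=> hF hG; apply/funext => L; apply/funext => eta.
have [n] := ubnP #|` L|; elim: n L => // n IH L; rewrite ltnS => Ln.
have := expansion_powerset L eta hF; rewrite (expansion_powerset L eta hG).
rewrite !big_fpowerset_top [X in _ + X = _](_ : _ =
  \sum_(M <- fpowerset L `\ L) F M eta); first by move/addIr.
rewrite big_seq [RHS]big_seq; apply: eq_bigr => M; rewrite in_fpowersetD1.
by move=> ML; apply/esym/IH/(leq_trans (fproper_ltn_card ML)).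
Qed.

Section Existence.
Variable f : finconf -> R^o.

Fixpoint inv_rec (n : nat) (L : {fset X}) (eta : X -> S) : R :=
  if n is m.+1 then
    f (restr L eta) - \sum_(M <- fpowerset L `\ L) inv_rec m M eta
  else 0.

Definition inv_exp (L : {fset X}) := inv_rec #|` L|.+1 L.

Lemma inv_recE n m L eta :
  (#|` L| < n)%N -> (#|` L| < m)%N -> inv_rec n L eta = inv_rec m L eta.
Proof.
elim: n m L => // n IH [//|m] L; rewrite !ltnS => Ln Lm /=.
congr (_ - _); rewrite big_seq [RHS]big_seq; apply: eq_bigr => M.
rewrite in_fpowersetD1 => /fproper_ltn_card ML.
by apply: IH; [exact: leq_trans Ln|exact: leq_trans Lm].
Qed.

Lemma inv_expE L eta :
  inv_exp L eta = f (restr L eta) - \sum_(M <- fpowerset L `\ L) inv_exp M eta.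
Proof.
rewrite {1}/inv_exp /=; congr (_ - _).
rewrite big_seq [RHS]big_seq; apply: eq_bigr => M.
by rewrite in_fpowersetD1 => /fproper_ltn_card ML; exact: inv_recE.
Qed.

Lemma sum_inv_exp L eta :
  \sum_(M <- fpowerset L) inv_exp M eta = f (restr L eta).
Proof. by rewrite big_fpowerset_top inv_expE subrK. Qed.

Lemma inv_exp_depends L : depends_on L (inv_exp L).
Proof.
have [n] := ubnP #|` L|; elim: n L => // n IH L; rewrite ltnS => Ln e e' ee'.
rewrite !inv_expE; congr (_ - _).
  by congr f; apply: finconf_eq => x /=; rewrite /restr_fun; case: ifP => // /ee'.
rewrite big_seq [RHS]big_seq; apply: eq_bigr => M; rewrite in_fpowersetD1 => ML.
apply: IH; first exact: leq_trans (fproper_ltn_card ML) Ln.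
by move=> x xM; apply: ee'; exact: (fsubsetP (fproper_sub ML)).
Qed.

Lemma inv_exp0 L (A : {fset X}) eta :
  ~~ (L `<=` A)%fset -> inv_exp L (sval (restr A eta)) = 0.
Proof.
have [n] := ubnP #|` L|; elim: n L => // n IH L; rewrite ltnS => Ln LA.
have LAL : (L `&` A `<` L)%fset.
  rewrite fproperEneq fsubsetIl andbT.
  by apply: contra LA => /eqP <-; exact: fsubsetIr.
rewrite inv_expE restr_restr.
have -> : restr (L `&` A) eta = restr (L `&` A) (sval (restr A eta)).
  by rewrite restr_restr -fsetIA fsetIid.
rewrite -sum_inv_exp; apply/eqP; rewrite subr_eq0; apply/eqP.
rewrite [RHS](big_fsetID _ (fun M => M `<=` A)%fset) /= [X in _ = _ + X]big1_fset.
  rewrite addr0; apply: congr_big => //; congr enum_fset.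
  apply/fsetP => M; rewrite fpowersetE fsubsetI !inE /= fpowersetE -fproperEneq.
  have [MA|] := boolP (M `<=` A)%fset; rewrite ?andbF // !andbT.
  apply/idP/idP => [ML|/fproper_sub//].
  by apply: fsub_proper_trans LAL; rewrite fsubsetI ML.
move=> M; rewrite !inE /= fpowersetE -fproperEneq => /andP[ML MA] _; apply: IH => //.
exact: leq_trans (fproper_ltn_card ML) Ln.
Qed.

Lemma inv_exp_expansion : is_expansion f inv_exp.
Proof.
have hC L : CLam L (inv_exp L).
  split; first exact: inv_exp_depends.
  by move=> A LA; apply/funext => eta; rewrite /iota_restr inv_exp0.
by split=> // eta; rewrite sum_CLam_supp // sum_inv_exp restr_supp.
Qed.

End Existence.

Lemma expansion_exists f : exists F, is_expansion f F.
Proof. by exists (inv_exp f); exact: inv_exp_expansion. Qed.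

Definition component (f : finconf -> R^o) : {fset X} -> (X -> S) -> R^o :=
  sval (cid (expansion_exists f)).

Lemma componentP f : is_expansion f (component f).
Proof. by rewrite /component; case: cid. Qed.

Lemma component_eq f F : is_expansion f F -> component f = F.
Proof. exact/expansion_unique/componentP. Qed.

Lemma component_linear (a : R) (f g : finconf -> R^o) L :
  component (a *: f + g) L = a *: component f L + component g L.
Proof.
suff -> : component (a *: f + g) =
  (fun L => a *: component f L + component g L) by [].
have [hf ef] := componentP f; have [hg eg] := componentP g.
have h M : CLam M (a *: component f M + component g M).
  split=> [e e' ee'|A MA]; last first.
    apply/funext => eta; rewrite /iota_restr.
    rewrite -[LHS]/(a * component f M (sval (restr A (sval eta)))
      + component g M (sval (restr A (sval eta)))).
    by rewrite (CLam0 _ (hf M)) // (CLam0 _ (hg M)) // mulr0 addr0.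
  rewrite -[LHS]/(a * component f M e + component g M e).
  by rewrite ((hf M).1 _ _ ee') ((hg M).1 _ _ ee').
apply: component_eq; split=> // eta.
rewrite (@sum_CLam_supp (fun L => a *: component f L + component g L)) // big_split /=.
rewrite -[LHS]/(a * f eta + g eta) ef eg (sum_CLam_supp _ hf).
by rewrite (sum_CLam_supp _ hg) mulr_sumr.
Qed.

Lemma component_cst (c : R) L :
  component (fun=> c) L = if L == fset0 then fun=> c else 0.
Proof.
pose F (L : {fset X}) : (X -> S) -> R^o := if L == fset0 then fun=> c else 0.
suff -> : component (fun=> c) = F by [].
have hF M : CLam M (F M).
  rewrite /F; case: eqP => [->|_]; last by split.
  by split=> // A; rewrite fsub0set.
apply: component_eq; split=> // eta; rewrite sum_CLam_supp //.
rewrite (big_fsetD1 fset0) ?fpowersetE ?fsub0set //= /F eqxx big1_fset ?addr0 //.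
by move=> M; rewrite in_fsetD1 => /andP[/negPf ->].
Qed.

Definition uniform (f : finconf -> R^o) : Prop :=
  exists r : R, 0 < r /\
    forall L : {fset X}, r < (diam E L)%:R -> component f L = 0.

Definition uniform_pred : {pred (finconf -> R^o)} := fun f => `[< uniform f >].

Lemma uniform_submod_closed : submod_closed uniform_pred.
Proof.
split=> [|a f g /asboolP[r [r0 hf]] /asboolP[s [s0 hg]]]; apply/asboolP.
  exists 1; split=> // L _.
  by rewrite -[0]/(fun=> 0 : R) component_cst; case: eqP.
exists (Num.max r s); split=> [|L]; first by rewrite lt_max r0.
by rewrite gt_max => /andP[/hf fL /hg gL]; rewrite component_linear fL gL scaler0 addr0.
Qed.
HB.instance Definition _ :=
  GRing.isSubmodClosed.Build R (finconf -> R^o) uniform_pred uniform_submod_closed.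

Record Cunif := MkCunif {
  cunif_fun : finconf -> R^o;
  cunif_uniform : cunif_fun \in uniform_pred }.
HB.instance Definition _ := [isSub for cunif_fun].
HB.instance Definition _ := [Choice of Cunif by <:].
HB.instance Definition _ := [SubChoice_isSubLmodule of Cunif by <:].

Definition cunif_const : {pred Cunif} :=
  fun f => `[< exists c, cunif_fun f = fun=> c >].

Lemma cunif_const_submod_closed : submod_closed cunif_const.
Proof.
split=> [|a f g /asboolP[c fc] /asboolP[d gd]]; apply/asboolP.
  by exists 0.
by exists (a * c + d); apply/funext => eta /=; rewrite fc gd.
Qed.
HB.instance Definition _ :=
  GRing.isSubmodClosed.Build R Cunif cunif_const cunif_const_submod_closed.

Definition C0unif := lquot cunif_const.
HB.instance Definition _ := GRing.Lmodule.on C0unif.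

(* The sum is finite when E is connected and locally finite, f is uniform and
   eta, eta' differ at finitely many places; \sum_(_ \in _) is 0 otherwise. *)
Definition difference (f : finconf -> R^o) (eta eta' : X -> S) : R :=
  \sum_(L \in [set L : {fset X} | exists2 x, x \in L & eta x <> eta' x])
    (component f L eta' - component f L eta).

Definition C0difference (f : C0unif) : (X -> S) -> (X -> S) -> R^o :=
  difference (cunif_fun (lrepr f)).

Lemma C0differenceE (f : Cunif) :
  C0difference (lproj cunif_const f) = difference (cunif_fun f).
Proof.
rewrite /C0difference; set g := lrepr _.
have /lprojP/asboolP[c] : lproj cunif_const g = lproj cunif_const f.
  by rewrite lreprK.
move=> gfc; have -> : cunif_fun g = 1 *: cunif_fun f + (fun=> c).
  by rewrite -gfc scale1r /= addrC subrK.
apply/funext => eta; apply/funext => eta'; rewrite /difference.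
apply: eq_fsbigr => L; rewrite inE /= => -[x xL _].
rewrite component_linear component_cst scale1r; case: eqP => [L0|_].
  by rewrite L0 in_fset0 in xL.
by rewrite addr0.
Qed.

Variable phi : set ((S * S) * (S * S)).

Definition PhiE : set ((X -> S) * (X -> S)) :=
  [set p | exists x y, [/\ E (x, y),
     phi ((p.1 x, p.1 y), (p.2 x, p.2 y)) &
     forall z, z <> x -> z <> y -> p.1 z = p.2 z]].

Definition antisym_form (w : {p | PhiE p} -> R^o) : Prop :=
  forall eta eta' (h : PhiE (eta, eta')) (h' : PhiE (eta', eta)),
    w (exist _ (eta', eta) h') = - w (exist _ (eta, eta') h).

Definition antisym_pred : {pred ({p | PhiE p} -> R^o)} :=
  fun w => `[< antisym_form w >].

Lemma antisym_submod_closed : submod_closed antisym_pred.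
Proof.
split=> [|a f g /asboolP hf /asboolP hg]; apply/asboolP => eta eta' h h'.
  by rewrite -[LHS]/0 -[X in - X]/0 oppr0.
rewrite -[LHS]/(a * f (exist _ _ h') + g (exist _ _ h')).
by rewrite hf hg mulrN -opprD.
Qed.
HB.instance Definition _ :=
  GRing.isSubmodClosed.Build R ({p | PhiE p} -> R^o) antisym_pred
    antisym_submod_closed.

Record C1 := MkC1 {
  c1_fun : {p | PhiE p} -> R^o;
  c1_antisym : c1_fun \in antisym_pred }.
HB.instance Definition _ := [isSub for c1_fun].
HB.instance Definition _ := [Choice of C1 by <:].
HB.instance Definition _ := [SubChoice_isSubLmodule of C1 by <:].

Lemma difference_antisym (f : finconf -> R^o) eta eta' :
  difference f eta' eta = - difference f eta eta'.
Proof.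
rewrite /difference -mulN1r mulr_fsumr.
rewrite [X in \sum_(_ \in X) _ = _](_ : _ =
  [set L : {fset X} | exists2 x, x \in L & eta x <> eta' x]).
  by apply: eq_fsbigr => L _; rewrite mulN1r opprB.
by apply/seteqP; split=> L [x xL /nesym h]; exists x.
Qed.

Definition differential_fun (f : C0unif) : {p | PhiE p} -> R^o :=
  fun p => C0difference f (sval p).1 (sval p).2.

Lemma differential_antisym (f : C0unif) : differential_fun f \in antisym_pred.
Proof. by apply/asboolP => eta eta' h h'; exact: difference_antisym. Qed.

Definition differential (f : C0unif) : C1 := MkC1 (differential_antisym f).

Definition H0unif : set C0unif := [set f | differential f = 0].

End BaseState.

Section Conserved.
Variable phi : set ((S * S) * (S * S)).

Definition exchangeable := forall s1 s2, joined phi (s1, s2) (s2, s1).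

Definition conserved (xi : S -> R^o) : Prop :=
  forall p q, joined phi p q -> xi p.1 + xi p.2 = xi q.1 + xi q.2.

Definition conserved_pred : {pred (S -> R^o)} := fun xi => `[< conserved xi >].

Lemma conserved_submod_closed : submod_closed conserved_pred.
Proof.
split=> [|a f g /asboolP hf /asboolP hg]; apply/asboolP => // p q pq.
rewrite -[LHS]/(a * f p.1 + g p.1 + (a * f p.2 + g p.2)).
rewrite -[RHS]/(a * f q.1 + g q.1 + (a * f q.2 + g q.2)).
by rewrite addrACA -mulrDr (hf _ _ pq) (hg _ _ pq) mulrDr addrACA.
Qed.
HB.instance Definition _ :=
  GRing.isSubmodClosed.Build R (S -> R^o) conserved_pred conserved_submod_closed.

Record conserved_quantity := MkConserved {
  cq_fun : S -> R^o;
  cq_conserved : cq_fun \in conserved_pred }.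
HB.instance Definition _ := [isSub for cq_fun].
HB.instance Definition _ := [Choice of conserved_quantity by <:].
HB.instance Definition _ := [SubChoice_isSubLmodule of conserved_quantity by <:].

Definition cq_const : {pred conserved_quantity} :=
  fun xi => `[< exists c, cq_fun xi = fun=> c >].

Lemma cq_const_submod_closed : submod_closed cq_const.
Proof.
split=> [|a f g /asboolP[c fc] /asboolP[d gd]]; apply/asboolP.
  by exists 0.
by exists (a * c + d); apply/funext => s /=; rewrite fc gd.
Qed.
HB.instance Definition _ :=
  GRing.isSubmodClosed.Build R conserved_quantity cq_const cq_const_submod_closed.

Definition Consv := lquot cq_const.
HB.instance Definition _ := GRing.Lmodule.on Consv.

End Conserved.

Section SiteSum.
Variables (E : set (X * X)) (b : S).

(* xi is normalised to vanish at the base state, so that the sum is finite. *)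
Definition site_sum (xi : S -> R^o) : finconf b -> R^o :=
  fun eta => \sum_(x \in [set: X]) (xi (sval eta x) - xi b).

Lemma component_site_sum (xi : S -> R^o) (L : {fset X}) :
  component (site_sum xi) L = if #|` L| == 1%N then
    fun eta => \sum_(x <- L) (xi (eta x) - xi b) else 0.
Proof.
pose F (L : {fset X}) : (X -> S) -> R^o := if #|` L| == 1%N then
    fun eta => \sum_(x <- L) (xi (eta x) - xi b) else 0.
suff -> : component (site_sum xi) = F by [].
apply: component_eq; split=> [{}L|eta].
  rewrite /F; case: ifPn => [/cardfs1P[x ->]|_]; last by split.
  split=> [e e' ee'|A].
    by rewrite !big_seq_fset1 ee' // in_fset1.
  rewrite fsub1set => xA; apply/funext => eta; rewrite /iota_restr big_seq_fset1.
  by rewrite /= /restr_fun (negPf xA) subrr.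
rewrite -(@fsbig_widen _ _ _ _ (range (@fset1 X))) //; last first.
  move=> {}L /= [_ hL]; rewrite /F; case: cardfs1P => // -[x Lx].
  by case: hL; exists x.
rewrite fsbig_image; last by move=> x y _ _; exact: fset1_inj.
by apply: eq_fsbigr => x _; rewrite /F cardfs1 eqxx big_seq_fset1.
Qed.

Lemma site_sum_uniform xi : site_sum xi \in @uniform_pred E b.
Proof.
apply/asboolP; exists 1; split=> // L; rewrite component_site_sum.
case: cardfs1P => // -[x ->]; rewrite /diam !big_seq_fset1 distxx.
by rewrite ltNge ler01.
Qed.

Variable phi : set ((S * S) * (S * S)).

Definition xiX (xi : Consv phi) : C0unif E b :=
  lproj (@cunif_const E b) (MkCunif (site_sum_uniform (cq_fun (lrepr xi)))).

Lemma xiXE (xi : conserved_quantity phi) :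
  xiX (lproj (@cq_const phi) xi) =
  lproj (@cunif_const E b) (MkCunif (site_sum_uniform (cq_fun xi))).
Proof.
have /lprojP/asboolP[c hc] : lproj (@cq_const phi) (lrepr (lproj (@cq_const phi) xi))
  = lproj (@cq_const phi) xi by rewrite lreprK.
rewrite /xiX; congr lproj; apply: val_inj; apply/funext => eta /=.
apply: eq_fsbigr => x _; set xi' := cq_fun (lrepr _).
have h s : xi' s = cq_fun xi s + c.
  by have /(congr1 (@^~ s)) := hc; rewrite -[LHS]/(xi' s - cq_fun xi s) => <-; rewrite addrC subrK.
by rewrite !h opprD addrACA subrr addr0.
Qed.

End SiteSum.

End Configurations.

Arguments H0unif R {X S} E b phi.
Arguments xiX R {X S} E b phi xi.

(* Main.v *)
Require Import Defs.
From mathcomp Require Import all_boot all_order all_algebra.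
From mathcomp Require Import finmap.
From mathcomp Require Import all_classical reals.
From mathcomp Require Import lra.

Set Implicit Arguments.
Unset Strict Implicit.
Unset Printing Implicit Defensive.

Import Order.TTheory GRing.Theory Num.Theory.

Local Open Scope classical_set_scope.
Local Open Scope ring_scope.

(** Let f be a uniform function with vanishing differential. Along a walk in
the interaction graph from (s1, s2) to (s2, s1), performed at the two ends of
an edge of X, the value of f does not change; so exchangeability makes f
invariant under the exchange of the values at two adjacent sites
([adjacent_swap_invariant]), and connectedness of X makes it invariant under
the exchange of the values at any two sites ([swap_invariant_joined]).

The expansion of f is unique, so this symmetry passes to the components: the
component at L and the component at the image of L by a transposition are the
same function up to relabelling of the sites ([component_swap]). If L has at
least two points, one of them can be exchanged with a site arbitrarily far from
another one, because balls are finite and X is infinite; uniformity kills the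
component at the new set, hence the component at L ([component_gt1]). Only the
constant and the one-site components remain, and the latter are all given by a
single function xi on S; so f is the sum of xi over the sites plus a constant
([eq_site_sum_cst]). Comparing f before and after a transition on one edge
shows that xi is conserved ([site_sum_conserved]); this gives surjectivity.

Conversely a transition changes at most two sites, so the difference of the
site sum of a conserved xi reduces to the conservation law
([difference_site_sum]), and xi is recovered up to a constant from the values
of its site sum on configurations with one occupied site ([xiX_inj]). *)

(** * Distances in an infinite, locally finite, connected graph *)

Section GraphDistance.
Variables (X : choiceType) (E : set (X * X)).
Hypotheses (E_conn : connected_digraph E) (E_lf : locally_finite E).

Lemma sphere_finite n x : finite_set [set y | walk E n x y].
Proof.
elim: n x => [|n IH] x.
  apply: (@sub_finite_set _ _ [set x]); last exact: finite_set1.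
  by move=> y [[|? ?] [_ /= <-]].
apply: (@sub_finite_set _ _
  (\bigcup_(e in [set e | E e /\ e.1 = x]) [set y | walk E n e.2 y])).
  move=> y [[|z p] [//= /andP[/asboolP xz zp] py [pn]]].
  by exists (x, z) => //=; exists p.
by apply: bigcup_finite => // e _; exact: IH.
Qed.

(** A ball is a finite union of sets of end points of walks of given length,
so together with A it cannot exhaust X. *)
Lemma far_point (X_inf : infinite_set [set: X]) n (A : {fset X}) y :
  exists2 z, z \notin A & (n < dist E y z)%N.
Proof.
pose B := [set` A] `|` \bigcup_(m in `I_n.+1) [set z | walk E m y z].
have Bfin : finite_set B.
  rewrite finite_setU; split; first exact: finite_fset.
  by apply: bigcup_finite => // m _; exact: sphere_finite.
have [z [_ zB]] := infinite_setN0 (infinite_setD X_inf Bfin).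
exists z; first by apply/negP => zA; apply: zB; left.
rewrite ltnNge; apply/negP => dn; apply: zB; right.
have [k yz] := E_conn y z; have [w _] := dist_walk yz.
by exists (dist E y z).
Qed.

Lemma dist_le_diam (L : {fset X}) x y :
  x \in L -> y \in L -> (dist E x y <= diam E L)%N.
Proof.
move=> xL yL.
apply: leq_trans (@leq_bigmax_seq _ (enum_fset L) xpredT (dist E x) y yL isT) _.
exact: (@leq_bigmax_seq _ (enum_fset L) xpredT
  (fun x => \max_(y <- L) dist E x y)%N x xL isT).
Qed.

(** E may contain loops. A walk between two different points has to leave its
starting point at some step, which is then not a loop. *)
Lemma exists_edge (X_inf : infinite_set [set: X]) :
  exists x y, E (x, y) /\ x <> y.
Proof.
have [x _] := infinite_setN0 X_inf.
have [z zx _] := far_point X_inf 0 [fset x]%fset x.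
have [n [p [pp pz _]]] := E_conn x z.
have {zx} : last x p <> x by rewrite pz => zx0; rewrite zx0 in_fset1 eqxx in zx.
elim: p x pp {z pz} => //= w p IH x /andP[/asboolP xw wp] px.
have [xew|/eqP] := eqVneq x w; last by exists x, w.
by apply: (IH w wp); rewrite -{2}xew.
Qed.

End GraphDistance.

(** * Components, differences and site sums *)

Section Configurations.
Variables (R : realType) (X : choiceType) (S : Type) (b : S).
Implicit Types (f : finconf X b -> R^o) (eta zeta : finconf X b).

Lemma component_inj f g : (forall L, component f L = component g L) -> f = g.
Proof.
move=> fg; apply/funext => eta; rewrite (componentP f).2 (componentP g).2.
by apply: eq_fsbigr => L _; rewrite fg.
Qed.

Lemma restr_id (A : {fset X}) eta :
  (supp eta `<=` A)%fset -> restr b A (sval eta) = eta.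
Proof.
move=> /fsubsetP sA; apply: finconf_eq => x /=; rewrite /restr_fun.
by case: ifPn => // xA; rewrite suppP //; apply: contra xA; exact: sA.
Qed.

(** The sum may run over all finite sets: a component does not see a change
outside its set of sites. *)
Lemma differenceE f (e e' : X -> S) :
  difference f e e' =
  \sum_(L \in [set: {fset X}]) (component f L e' - component f L e).
Proof.
apply: fsbig_widen => // L [_ nL] /=; apply/eqP; rewrite subr_eq0; apply/eqP.
apply: ((componentP f).1 L).1 => x xL; apply: contrapT => /nesym ne.
by apply: nL; exists x.
Qed.

(** On finitely supported configurations the formal difference is the true
one, since both expansions can be summed over the subsets of one finite set. *)
Lemma difference_finconf f eta zeta :
  difference f (sval eta) (sval zeta) = f zeta - f eta.
Proof.
rewrite differenceE; pose A := (supp eta `|` supp zeta)%fset.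
have eA : restr b A (sval eta) = eta by rewrite restr_id // fsubsetUl.
have zA : restr b A (sval zeta) = zeta by rewrite restr_id // fsubsetUr.
rewrite (@fsbigTE _ _ _ _ (fpowerset A)); last first.
  move=> L; rewrite fpowersetE => LA; rewrite -eA -zA.
  by rewrite !(CLam0 _ ((componentP f).1 L)) // subrr.
rewrite sumrB -!(expansion_powerset A _ (componentP f)).
by rewrite eA zA.
Qed.

Lemma site_sumE (A : {fset X}) (xi : S -> R^o) eta :
  (supp eta `<=` A)%fset ->
  site_sum xi eta = \sum_(x <- A) (xi (sval eta x) - xi b).
Proof.
move=> /fsubsetP sA; apply: fsbigTE => x xA.
by rewrite suppP ?subrr //; apply: contra xA; exact: sA.
Qed.

Lemma site_sum_linear a (xi zeta : S -> R^o) :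
  site_sum (b := b) (a *: xi + zeta) =
  a *: (site_sum xi : finconf X b -> R^o) + site_sum zeta.
Proof.
apply/funext => eta; rewrite -[RHS]/(a * site_sum xi eta + site_sum zeta eta).
rewrite !(@site_sumE (supp eta)) // mulr_sumr -big_split.
apply: eq_bigr => x _ /=.
rewrite -[X in X - _]/(a * xi (sval eta x) + zeta (sval eta x)).
rewrite -[X in _ - X]/(a * xi b + zeta b).
by rewrite mulrBr opprD addrACA.
Qed.

(** * Exchanging the values at two sites *)

Definition put x y (p : S * S) (e : X -> S) : X -> S :=
  fun z => if z == x then p.1 else if z == y then p.2 else e z.

Lemma put_finite x y p eta : finite_set [set z | put x y p (sval eta) z <> b].
Proof.
apply: (@sub_finite_set _ _ [set` (supp eta `|` [fset x; y])%fset]).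
  move=> z /=; rewrite /put !inE.
  case: (z == x); first by rewrite orbT.
  case: (z == y); first by rewrite !orbT.
  by rewrite !orbF => h; apply: contrapT => /negP zN; apply: h; exact: suppP.
exact: finite_fset.
Qed.

Definition fput x y p eta : finconf X b :=
  exist _ (put x y p (sval eta)) (put_finite x y p eta).

Definition fswap x y eta : finconf X b :=
  fput x y (sval eta y, sval eta x) eta.

Lemma fput_id x y eta : fput x y (sval eta x, sval eta y) eta = eta.
Proof.
by apply: finconf_eq => z /=; rewrite /put; do 2?case: eqP => [->//|_].
Qed.

Definition transp (x y : X) : X -> X :=
  fun z => if z == x then y else if z == y then x else z.

Lemma fswapE x y eta : sval (fswap x y eta) = sval eta \o transp x y.
Proof.
by apply/funext => z /=; rewrite /put /transp; do 2?case: eqP => _.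
Qed.

Lemma transpK x y : involutive (transp x y).
Proof.
move=> z; rewrite /transp.
have [->|zx] := eqVneq z x; first by rewrite eqxx; case: eqVneq.
have [->|zy] := eqVneq z y; first by rewrite eqxx.
by rewrite (negPf zx) (negPf zy).
Qed.

Lemma mem_transp x y (L : {fset X}) z :
  (z \in (transp x y @` L)%fset) = (transp x y z \in L).
Proof.
by rewrite -[z in LHS](transpK x y) mem_imfset //=; exact: inv_inj (transpK x y).
Qed.

Lemma transp_fsetK x y : involutive (fun L : {fset X} => transp x y @` L)%fset.
Proof. by move=> L; apply/fsetP => z; rewrite !mem_transp transpK. Qed.

Definition swap_invariant f x y := forall eta, f (fswap x y eta) = f eta.

(** This is the identity (x z) = (x y) (y z) (x y), valid for distinct x, y, z;
the cases with a coincidence are separate. *)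
Lemma swap_invariant_trans f x y z :
  swap_invariant f x y -> swap_invariant f y z -> swap_invariant f x z.
Proof.
have [<- //|xy] := eqVneq x y; have [<- //|yz] := eqVneq y z.
have [<- _ _ eta|xz hxy hyz eta] := eqVneq x z.
  by congr f; apply: finconf_eq => w; rewrite fswapE /= /transp; case: eqP => [->|].
rewrite (_ : fswap x z eta = fswap x y (fswap y z (fswap x y eta))).
  by rewrite hxy hyz hxy.
apply: finconf_eq => w; rewrite !fswapE /=; congr (sval eta _); rewrite /transp.
have [_|wx] := eqVneq w x.
  by rewrite /= eqxx [z == x]eq_sym (negPf xz) [z == y]eq_sym (negPf yz).
have [->|wy] := eqVneq w y.
  by rewrite (negPf yz) /= [x == y](negPf xy) (negPf xz) eqxx.
have [_|wz] := eqVneq w z; last by rewrite (negPf wy) (negPf wx) (negPf wy).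
by rewrite (negPf wy) [y == x]eq_sym (negPf xy) eqxx.
Qed.

Lemma swap_invariant_joined (E : set (X * X)) f :
  (forall x y, E (x, y) -> swap_invariant f x y) ->
  forall x y, joined E x y -> swap_invariant f x y.
Proof.
move=> hE x y [n [p [pp <- _]]] {y n}; elim: p x pp => [|z p IH] x /=.
  move=> _ eta; congr f; apply: finconf_eq => w.
  by rewrite fswapE /= /transp; case: eqP => [->|].
by move=> /andP[/asboolP xz zp]; exact: swap_invariant_trans (hE _ _ xz) (IH _ zp).
Qed.

(** Relabelling the sites turns the expansion of f into an expansion of f
composed with the exchange, that is of f again, and expansions are unique. *)
Lemma component_swap f x y L (e : X -> S) : swap_invariant f x y ->
  component f (transp x y @` L)%fset (e \o transp x y) = component f L e.
Proof.
move=> hf; pose t := transp x y; rewrite -/t; have tK : involutive t := transpK x y.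
pose F (L : {fset X}) (e : X -> S) := component f (t @` L)%fset (e \o t).
suff FE : component f = F by rewrite [in RHS]FE.
have [hC fE] := componentP f.
apply: component_eq; split=> [{}L|eta]; last first.
  rewrite -hf fE fswapE (reindex_fsbigT (fun L : {fset X} => t @` L)%fset) //.
  exact: inv_bij (transp_fsetK x y).
split=> [e1 e2 e12|A LA].
  by apply: (hC _).1 => z; rewrite mem_transp => /e12.
apply/funext => eta; rewrite /iota_restr /F.
have -> : sval (restr b A (sval eta)) \o t =
          sval (restr b (t @` A)%fset (sval eta \o t)).
  by apply/funext => z /=; rewrite /restr_fun mem_transp.
apply: (CLam0 _ (hC _)); apply: contra LA => /fsubsetP LA.
apply/fsubsetP => z zL; have := LA (t z).
by rewrite !mem_transp -/t !tK => /(_ zL).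
Qed.

(** * Symmetric uniform functions are site sums *)

Section SymmetricUniform.
Variable E : set (X * X).
Hypotheses (E_conn : connected_digraph E) (E_lf : locally_finite E).
Hypothesis X_inf : infinite_set [set: X].
Variable f : finconf X b -> R^o.
Hypotheses (f_unif : uniform E f) (f_sym : forall x y, swap_invariant f x y).

(** For two points x, y of L, exchanging x with a far site z carries L to a set
that contains both y and z, whose diameter exceeds the range of f. *)
Lemma component_gt1 (L : {fset X}) : (1 < #|` L|)%N -> component f L = 0.
Proof.
move=> L1; have [r [r0 hr]] := f_unif.
have /fset0Pn[x xL] : L != fset0 by rewrite -cardfs_gt0; exact: ltnW.
have /fset0Pn[y] : (L `\ x)%fset != fset0.
  by rewrite -cardfs_gt0 -ltnS -add1n; rewrite (cardfsD1 x) xL in L1.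
rewrite in_fsetD1 => /andP[yx yL].
have [z zL yz] := far_point E_conn E_lf X_inf (Num.bound r) L y.
apply/funext => e; rewrite -(component_swap L e (f_sym x z)) hr //.
apply: lt_le_trans (archi_boundP (ltW r0)) _; rewrite ler_nat.
apply: leq_trans (ltnW yz) _; apply: dist_le_diam; rewrite mem_transp /transp.
  by rewrite (negPf yx); case: eqP => [yez|//]; rewrite -yez yL in zL.
by rewrite eqxx; case: eqP => [zx|//]; rewrite zx xL in zL.
Qed.

(** The function xi is the component at one chosen site; by symmetry the
components at the other sites are given by the same function. *)
Lemma eq_site_sum_cst : exists (xi : S -> R^o) (c : R),
  f = (site_sum xi : finconf X b -> R^o) + (fun=> c).
Proof.
have [x0 _] := infinite_setN0 X_inf.
pose xi s := component f [fset x0]%fset (fun=> s).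
have hC := (componentP f).1.
have xib : xi b = 0.
  rewrite /xi -[RHS](CLam0 (A := fset0) (fun=> b) (hC [fset x0]%fset)).
    by congr component.
  by rewrite fsub1set in_fset0.
exists xi, (component f fset0 (fun=> b)); apply: component_inj => L.
rewrite -[site_sum xi]scale1r component_linear component_cst component_site_sum.
rewrite scale1r; have [->|L0] := eqVneq L fset0.
  rewrite cardfs0 /= add0r; apply/funext => e.
  by apply: (hC fset0).1 => x; rewrite in_fset0.
rewrite addr0; case: cardfs1P => [[x ->]|L1]; last first.
  apply: component_gt1; rewrite ltn_neqAle cardfs_gt0 L0 andbT eq_sym.
  exact/cardfs1P.
apply/funext => e; rewrite big_seq_fset1 xib subr0 /xi.
rewrite -[RHS](component_swap _ _ (f_sym x0 x)).
rewrite (_ : transp x0 x @` _ = [fset x])%fset.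
  by apply: (hC _).1 => z; rewrite in_fset1 => /eqP ->.
apply/fsetP => z; rewrite mem_transp !in_fset1 /transp.
have [->|zx0] := eqVneq z x0; first by rewrite eq_sym.
by case: (eqVneq z x); rewrite ?eqxx ?(negPf zx0).
Qed.

End SymmetricUniform.

(** * Closed functions and conserved quantities *)

Section Interaction.
Variables (phi : set ((S * S) * (S * S))) (E : set (X * X)).

Section Closed.
Variable f : finconf X b -> R^o.
Hypothesis f_closed : forall e e', PhiE E phi (e, e') -> difference f e e' = 0.

(** Each step of a walk from p to q in the interaction graph is a transition
of configurations at the edge (x, y), and f is constant along transitions. *)
Lemma put_invariant x y p q eta :
  E (x, y) -> x <> y -> joined phi p q -> f (fput x y p eta) = f (fput x y q eta).
Proof.
move=> Exy /eqP xy [n [s [ps <- _]]] {q n}.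
elim: s p ps => //= r s IH p /andP[/asboolP pr rs]; rewrite -{}IH //.
apply/esym/eqP; rewrite -subr_eq0 -difference_finconf; apply/eqP/f_closed.
exists x, y; split=> //=.
  by rewrite /put !eqxx [y == x]eq_sym (negPf xy) -!surjective_pairing.
by move=> z /eqP zx /eqP zy; rewrite /put (negPf zx) (negPf zy).
Qed.

Lemma adjacent_swap_invariant (phi_exch : exchangeable phi) x y :
  E (x, y) -> swap_invariant f x y.
Proof.
move=> Exy eta; have [<-|/eqP xy] := eqVneq x y.
  exact: (congr1 f (fput_id x x eta)).
by rewrite -[in RHS](fput_id x y eta); exact: put_invariant.
Qed.

End Closed.

(** The values of the site sum are compared on configurations that are
in the base state outside x and y, where the sum has only two terms. *)
Lemma site_sum_conserved x y (xi : S -> R^o) (c : R) :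
  x <> y -> E (x, y) ->
  (forall e e', PhiE E phi (e, e') ->
    difference ((site_sum xi : finconf X b -> R^o) + (fun=> c)) e e' = 0) ->
  conserved phi xi.
Proof.
move=> xy Exy h p q pq; pose vac : finconf X b := restr b fset0 (fun=> b).
have site_sum_put r : site_sum xi (fput x y r vac) = xi r.1 + xi r.2 - xi b *+ 2.
  rewrite (@site_sumE [fset x; y]%fset); last first.
    apply/fsubsetP => z; apply: contraLR; rewrite in_fset2 negb_or => /andP[zx zy].
    rewrite in_fset_set; last exact: (svalP (fput x y r vac)).
    by apply/negP; rewrite inE /= /put (negPf zx) (negPf zy).
  rewrite big_fsetU1 ?in_fset1 //=; last exact/eqP.
  rewrite big_seq_fset1 /put !eqxx [y == x]eq_sym; move/eqP/negPf: xy => ->.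
  by rewrite addrACA -opprD.
have := put_invariant h vac Exy xy pq.
rewrite -[LHS]/(site_sum xi _ + c) -[RHS]/(site_sum xi _ + c) !site_sum_put.
by move/addIr/addIr.
Qed.

(** Only the components at x and at y can change under a transition at the
edge (x, y), and the total change is the defect of the conservation law. For a
loop, x = y, only one term remains, and the law says that its double is 0. *)
Lemma difference_site_sum (xi : S -> R^o) (e e' : X -> S) :
  conserved phi xi -> PhiE E phi (e, e') ->
  difference (site_sum xi : finconf X b -> R^o) e e' = 0.
Proof.
move=> hxi [x [y [/= _ st off]]].
have {}hxi : xi (e x) + xi (e y) = xi (e' x) + xi (e' y).
  by apply: (hxi (_, _) (_, _)); exists 1%N, [:: (e' x, e' y)]; split=> //=;
    rewrite andbT; apply/asboolP.
have cE z (w : X -> S) :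
    component (site_sum xi : finconf X b -> R^o) [fset z]%fset w = xi (w z) - xi b.
  by rewrite component_site_sum cardfs1 eqxx big_seq_fset1.
rewrite differenceE (@fsbigTE _ _ _ _ [fset [fset x]; [fset y]]%fset).
  have [yx|xy] := eqVneq y x.
    rewrite yx in hxi *; rewrite fsetUid big_seq_fset1 !cE.
    by move: (xi _) (xi _) (xi b) hxi => u v w; lra.
  rewrite big_fsetU1 /=; last first.
    by rewrite in_fset1; apply: contra xy => /eqP/fset1_inj ->.
  rewrite big_seq_fset1 !cE.
  by move: (xi _) (xi _) (xi _) (xi _) (xi b) hxi => u v u' v' w; lra.
move=> L; rewrite in_fset2 component_site_sum; case: cardfs1P => [[z ->]|_ _].
  rewrite negb_or => /andP[zx zy]; rewrite !big_seq_fset1 off ?subrr //.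
    by move=> h; rewrite h eqxx in zx.
  by move=> h; rewrite h eqxx in zy.
by rewrite subrr.
Qed.

End Interaction.

End Configurations.

(** * The map from conserved quantities to uniform cohomology *)

Section SiteSumMap.
Variables (R : realType) (X : choiceType) (S : Type) (b : S).
Variables (E : set (X * X)) (phi : set ((S * S) * (S * S))).

Lemma H0unifP (f : Cunif R E b) :
  H0unif R E b phi (lproj (@cunif_const R X S E b) f) <->
  forall e e', PhiE E phi (e, e') -> difference (cunif_fun f) e e' = 0.
Proof.
rewrite /H0unif /= -C0differenceE; split=> [h e e' ee'|h].
  exact: (congr1 (fun w => c1_fun w (exist _ (e, e') ee')) h).
by apply: val_inj; apply/funext => -[[e e'] ee']; exact: h.
Qed.

Lemma xiX_linear : linear (xiX R E b phi).
Proof.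
move=> a p q; rewrite -[p]lreprK -[q]lreprK -linearP !xiXE -linearP.
by congr lproj; apply: val_inj; exact: site_sum_linear.
Qed.

Lemma xiX_H0unif p : H0unif R E b phi (xiX R E b phi p).
Proof.
apply/H0unifP => e e'; apply: difference_site_sum.
exact/asboolP/(cq_conserved (lrepr p)).
Qed.

(** The configuration equal to s at the site x and to the base state elsewhere
turns an equality of site sums up to a constant into one of functions on S. *)
Lemma xiX_inj (x : X) : injective (xiX R E b phi).
Proof.
move=> p q; rewrite -[p]lreprK -[q]lreprK !xiXE => /lprojP/asboolP[c hc].
apply/lprojP/asboolP.
pose xi := cq_fun (lrepr p); pose zeta := cq_fun (lrepr q).
pose one s : finconf X b := restr b [fset x]%fset (fun=> s).
have site_sum_one (h : S -> R^o) s : site_sum h (one s) = h s - h b.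
  rewrite (@site_sumE _ _ _ _ [fset x]%fset).
    by rewrite big_seq_fset1 /= /restr_fun in_fset1 eqxx.
  apply/fsubsetP => z; apply: contraLR => zx.
  rewrite in_fset_set; last exact: (svalP (one s)).
  by apply/negP; rewrite inE /= /restr_fun (negPf zx).
(* Site sums are normalised at b, which shifts the difference by this constant. *)
exists (xi b - zeta b); apply/funext => s.
rewrite -[LHS]/(xi s - zeta s).
have hs r : site_sum xi (one r) - site_sum zeta (one r) = c.
  exact: (congr1 (@^~ (one r)) hc).
have := hs s; rewrite -(hs b) !site_sum_one.
by move: (xi s) (zeta s) (xi b) (zeta b) => u v w t; lra.
Qed.

Hypotheses (E_conn : connected_digraph E) (E_lf : locally_finite E).
Hypotheses (X_inf : infinite_set [set: X]) (phi_exch : exchangeable phi).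

Lemma xiX_surj : H0unif R E b phi `<=` range (xiX R E b phi).
Proof.
move=> q; rewrite -[q]lreprK; move: (lrepr q) => f /H0unifP f_closed {q}.
have f_sym x y : swap_invariant (cunif_fun f) x y.
  apply: swap_invariant_joined (E_conn x y) => {}x {}y.
  exact: (adjacent_swap_invariant f_closed phi_exch).
have /asboolP f_unif := cunif_uniform f.
have [xi [c fE]] := eq_site_sum_cst E_conn E_lf X_inf f_unif f_sym.
have [x [y [Exy xy]]] := exists_edge E_conn E_lf X_inf.
have xi_cons : xi \in conserved_pred phi.
  by apply/asboolP; rewrite fE in f_closed; exact: site_sum_conserved Exy f_closed.
exists (lproj (@cq_const R S phi) (MkConserved xi_cons)) => //; rewrite xiXE.
apply/lprojP/asboolP; exists (- c); apply/funext => eta /=.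
rewrite -[LHS]/(site_sum xi eta - cunif_fun f eta) fE.
by rewrite -[X in _ - X]/(site_sum xi eta + c) opprD addNKr.
Qed.

End SiteSumMap.

Theorem corollary1p4 (R : realType)
    (S : Type) (phi : set ((S * S) * (S * S)))
    (phi_sym : symmetric_digraph phi) (phi_exch : exchangeable phi)
    (X : choiceType) (E : set (X * X))
    (E_sym : symmetric_digraph E) (E_conn : connected_digraph E)
    (E_lf : locally_finite E) (X_inf : infinite_set [set: X])
    (b : S) :
  linear (xiX R E b phi) /\
  set_bij [set: Consv R phi] (H0unif R E b phi) (xiX R E b phi).
Proof.
split; first exact: xiX_linear.
have [x _] := infinite_setN0 X_inf.
split; first by move=> p _; exact: xiX_H0unif.
  by move=> p q _ _; exact: xiX_inj.
exact: xiX_surj.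
Qed.
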